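(* Let $X\in L^\infty$ and let $\mathcal{G}\subseteq\mathcal{H}$ be sub-$\sigma$-fields of $\mathcal{F}$. If $Y\in\mathbb{E}[X\mid\mathcal{H}]$ and $Z\in\mathbb{E}[Y\mid\mathcal{G}]$, then $Z\in\mathbb{E}[X\mid\mathcal{G}]$.
   Context: $\mathbb{K}$ is a local field with non-archimedean absolute value $|\cdot|$ satisfying $|x|=0 \iff x=0$, $|xy|=|x||y|$, $|x+y|\le|x|\vee|y|$. $(\Omega,\mathcal{F},\mathbb{P})$ is a probability space; all (in)equalities are a.s. $L^\infty$ is the space of $\mathbb{K}$-valued random variables $X$ with $\operatorname{ess\,sup}|X|<\infty$; $L^\infty(\mathcal{G})$ its $\mathcal{G}$-measurable subspace. For a non-negative real random variable $S$, $\operatorname{ess\,sup}\{S\mid\mathcal{G}\}:=\sup_{p\ge1}\mathbb{E}[S^p\mid\mathcal{G}]^{1/p}$ (usual real conditional expectation), $\|X\|_\mathcal{G}:=\operatorname{ess\,sup}\{|X|\mid\mathcal{G}\}$, and the conditional expectation is the set $\mathbb{E}[X\mid\mathcal{G}]:=\{Y\in L^\infty(\mathcal{G}): \|X-Y\|_\mathcal{G}\le\|X-Z\|_\mathcal{G}\text{ for all }Z\in L^\infty(\mathcal{G})\}$. *)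

(* Defs.v *)
From HB Require Import structures.
From mathcomp Require Import all_boot all_order all_algebra.
From mathcomp Require Import all_classical all_reals all_analysis.
Set Implicit Arguments. Unset Strict Implicit. Unset Printing Implicit Defensive.
Import Order.TTheory GRing.Theory Num.Theory.
Local Open Scope classical_set_scope.
Local Open Scope ring_scope.

Definition kball (K : fieldType) (R : realType) (absK : K -> R) (a : K) (r : R)
  : set K := [set x | absK (x - a) < r].

Definition kopen (K : fieldType) (R : realType) (absK : K -> R) (U : set K) :=
  forall x, U x -> exists2 e : R, 0 < e & kball absK x e `<=` U.

Definition kcompact (K : fieldType) (R : realType) (absK : K -> R) (B : set K) :=
  forall (I : Type) (U : I -> set K), (forall i, kopen absK (U i)) ->
    B `<=` \bigcup_i U i ->
    exists2 D : set I, finite_set D & B `<=` \bigcup_(i in D) U i.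

(** [absK] is a non-archimedean absolute value making K a local field:
    the three axioms of the paper (plus nonnegativity, implicit in
    "absolute value"), nontriviality, and local compactness (the closed
    unit ball is compact). *)
Definition local_field_abs (K : fieldType) (R : realType) (absK : K -> R) :=
  (forall x, 0 <= absK x) /\
  [/\ 
      (forall x, absK x = 0 <-> x = 0),
      (forall x y, absK (x * y) = absK x * absK y),
      (forall x y, absK (x + y) <= Num.max (absK x) (absK y)),
      (exists x, absK x != 0 /\ absK x != 1) &
      kcompact absK [set x | absK x <= 1]].

Section Prob.
Context (d : measure_display) (T : measurableType d) (R : realType)
  (P : probability T R).

Definition sub_sigma_field (G : set (set T)) :=
  sigma_algebra setT G /\ G `<=` measurable.

(** G-measurability of a K-valued map (Borel sigma-field of the metric
    topology of K, i.e. generated by the open sets). *)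
Definition kmeasurable (K : fieldType) (absK : K -> R) (G : set (set T))
  (X : T -> K) := forall U, kopen absK U -> G (X @^-1` U).

Definition rmeasurable (G : set (set T)) (f : T -> R) :=
  forall B : set R, measurable B -> G (f @^-1` B).

Definition Linf (K : fieldType) (absK : K -> R) (G : set (set T)) (X : T -> K) :=
  kmeasurable absK G X /\ exists M : R, {ae P, forall w, absK (X w) <= M}.

Definition cexp_version (G : set (set T)) (S W : T -> R) :=
  [/\ rmeasurable G W, P.-integrable setT (EFin \o W) &
      forall A, G A -> (\int[P]_(w in A) (W w)%:E = \int[P]_(w in A) (S w)%:E)%E].

(** [V] is a version of ess sup{S | G} := sup_{p >= 1} E[S^p | G]^(1/p),
    computed from versions [Wp p] of E[S^(p+1) | G]. *)
Definition is_cond_esssup (G : set (set T)) (S : T -> R) (V : T -> \bar R) :=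
  exists Wp : nat -> T -> R,
    (forall p : nat, cexp_version G (fun w => S w ^+ p.+1) (Wp p)) /\
    V = fun w => ereal_sup (range (fun p : nat => (Wp p w `^ (p.+1%:R^-1))%:E)).

(** Y belongs to the (non-archimedean) conditional expectation E[X | G]:
    Y in L^infty(G) and ||X - Y||_G <= ||X - Z||_G a.s. for all Z in L^infty(G)
    (for any versions of the conditional essential suprema). *)
Definition in_cond_exp (K : fieldType) (absK : K -> R) (G : set (set T))
  (X Y : T -> K) :=
  Linf absK G Y /\
  forall Z, Linf absK G Z ->
  forall V1 V2, is_cond_esssup G (fun w => absK (X w - Y w)) V1 ->
                is_cond_esssup G (fun w => absK (X w - Z w)) V2 ->
                {ae P, forall w, (V1 w <= V2 w)%E}.

End Prob.

(* Main.v *)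
(* ess sup{S | G} is the least G-measurable a.e. upper bound of S >= 0; both
   halves of this are checked on the sublevel sets at rational heights. Let Z'
   be G-measurable and V = ||X - Z'||_G. Since V is H-measurable and dominates
   |X - Z'|, minimality of Y gives |X - Y| <= ||X - Y||_H <= ||X - Z'||_H <= V.
   The ultrametric inequality gives |Y - Z'| <= V, then minimality of Z gives
   |Y - Z| <= ||Y - Z||_G <= ||Y - Z'||_G <= V, and once more |X - Z| <= V.
   Hence ||X - Z||_G <= V. Conditional versions have to be shown to exist,
   otherwise the minimality hypotheses would be vacuous. *)
Require Import Defs.
From HB Require Import structures.
From mathcomp Require Import all_boot all_order all_algebra.
From mathcomp Require Import all_classical all_reals all_analysis.
From mathcomp Require Import measurable_realfun.
Set Implicit Arguments. Unset Strict Implicit. Unset Printing Implicit Defensive.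
Import Order.TTheory GRing.Theory Num.Theory.
Import numFieldNormedType.Exports.
Local Open Scope classical_set_scope.
Local Open Scope ring_scope.

(** * Almost-everywhere arguments *)

(** Countably many null sets have a null union. The main use is to collect conditions at all pairs
    of rational heights into one exceptional set. *)
Lemma ae_forall_countable (d : measure_display) (T : measurableType d)
    (R : realType) (mu : {measure set T -> \bar R}) (I : countType)
    (Q : I -> T -> Prop) :
  (forall i, {ae mu, forall w, Q i w}) -> {ae mu, forall w, forall i, Q i w}.
Proof.
move=> Qae.
have : {ae mu, forall w, forall n, if unpickle n is Some i then Q i w else True}.
  apply: ae_foralln => n; case: (unpickle n) => [i|]; first exact: Qae.
  exact: aeW.
by apply: filterS => w Qw i; have := Qw (pickle i); rewrite pickleK.
Qed.

(** Positivity turns the hypothesis into a zero integral of [|f|], so [f] vanishes a.e. on [A],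
    where it never vanishes. It is applied below to sets on which a desired inequality fails. *)
Lemma measure0_integral_gt0 (d : measure_display) (T : measurableType d)
    (R : realType) (mu : {measure set T -> \bar R}) (A : set T)
    (f : T -> \bar R) :
  measurable A -> measurable_fun A f -> (forall w, A w -> (0 < f w)%E) ->
  (\int[mu]_(w in A) f w <= 0)%E -> mu A = 0%E.
Proof.
move=> mA mf f0 If.
have : (\int[mu]_(w in A) `|f w| = 0)%E.
  under eq_integral => w /set_mem Aw do rewrite gee0_abs ?(ltW (f0 _ Aw))//.
  apply/eqP; rewrite eq_le If/=; apply: integral_ge0 => w Aw.
  exact/ltW/f0.
move=> /(ae_eq_integral_abs mu mA mf) fae.
apply/negligibleP => //; apply: negligibleS fae => w Aw /= /(_ Aw) fw.
by have := f0 _ Aw; rewrite fw ltxx.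
Qed.

(** * Existence of real conditional expectations *)

Lemma rmeasurable_measurable_fun (d : measure_display) (T : measurableType d)
    (R : realType) (G : set (set T)) (f : T -> R) :
  sub_sigma_field G -> rmeasurable G f -> measurable_fun setT f.
Proof. by move=> [_ GF] mf _ B mB; rewrite setTI; apply/GF/mf. Qed.

(* Radon-Nikodym on (T, G): both P and the charge S.P are pushed forward along
   the identity from T to T equipped with the sigma-field G. *)
Lemma cexp_version_exists (d : measure_display) (T : measurableType d)
    (R : realType) (P : probability T R) (G : set (set T)) (S : T -> R) :
  sub_sigma_field G -> P.-integrable setT (EFin \o S) ->
  exists W, cexp_version P G S W.
Proof.
move=> [sG GF] iS.
pose TG := g_sigma_algebraType G.
have mGE : @measurable _ TG = G by exact: measurable_g_measurableTypeE.
pose i : T -> TG := id.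
have mi : measurable_fun setT i.
  by move=> _ A; rewrite mGE setTI => GA; exact: GF.
pose iM : {mfun T >-> TG} := HB.pack i (isMeasurableFun.Build _ _ _ _ i mi).
pose mu : probability TG R := distribution P iM.
pose nu0 : {charge set T -> \bar R} := induced_charge iS.
pose nu_ : {charge set TG -> \bar R} := pushforward nu0 i.
pose nu := nu_ mi.
have numu : nu `<< mu.
  apply/null_content_dominatesP => A mA PA.
  have mA' : d.-measurable (A : set T) by apply: GF; rewrite -mGE.
  apply: null_set_integral => //.
  by apply: measurable_funTS; exact: measurable_int iS.
pose f := Radon_Nikodym nu mu.
have fi : mu.-integrable setT f by exact: Radon_Nikodym_integrable.
have ffin w : f w \is a fin_num by exact: Radon_Nikodym_fin_num.
have mf : measurable_fun setT f := measurable_int _ fi.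
have fE : EFin \o (fine \o f) = f by apply/funext => w /=; rewrite fineK.
(* The change of variables along the identity brings integrability of the density back from [mu] to
   [P]. *)
have fiT : P.-integrable setT f.
  apply/integrableP; split.
    exact: (measurableT_comp mf mi).
  have /integrableP[_] := fi.
  rewrite ge0_integral_pushforward//.
  by apply: measurableT_comp.
exists (fine \o f); split.
- move=> B mB; rewrite -mGE -[X in measurable X]setTI.
  by apply: (measurableT_comp _ mf) => //; exact: measurable_fine.
- by rewrite fE.
move=> A GA.
have mA : @measurable _ TG A by rewrite mGE.
have := Radon_Nikodym_integral numu mA.
(* By conversion [nu A] is the integral of [S] over the preimage of [A] under the identity, which is
   [A] itself. *)
rewrite -[LHS]/(\int[P]_(w in A) (S w)%:E)%E => ->.
rewrite integral_pushforward//; last first.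
  by apply: integrableS fiT => //; exact: GF.
by apply: eq_integral => w _; rewrite fineK.
Qed.

(** * Ultrametric geometry and measurability of distances *)

(** [absK 1] is a nonzero idempotent, and [absK (-1)] is a nonnegative real whose square is
    [absK 1]. *)
Lemma absK_normalized (K : fieldType) (R : realType) (absK : K -> R) :
  local_field_abs absK -> absK 1 = 1 /\ absK (-1) = 1.
Proof.
move=> [abs0 [abs_eq0 absM _ _ _]].
have abs1 : absK 1 = 1.
  have n0 : absK 1 != 0 by apply/eqP => /abs_eq0/eqP; rewrite oner_eq0.
  by apply: (mulfI n0); rewrite -absM !mulr1.
split => //; apply/eqP; rewrite -(@eqrXn2 _ 2)// expr1n expr2 -absM.
by rewrite mulrNN mulr1 abs1.
Qed.

Lemma absK_distC (K : fieldType) (R : realType) (absK : K -> R) (x y : K) :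
  local_field_abs absK -> absK (x - y) = absK (y - x).
Proof.
move=> HK; have [_ absN1] := absK_normalized HK.
case: HK => _ [_ absM _ _ _].
by rewrite -opprB -mulN1r absM absN1 mul1r.
Qed.

Lemma absK_dist_max (K : fieldType) (R : realType) (absK : K -> R)
    (x y z : K) :
  local_field_abs absK ->
  absK (x - z) <= Num.max (absK (x - y)) (absK (y - z)).
Proof. by move=> [_ [_ _ absD _ _]]; rewrite -(subrKA y). Qed.

Lemma kopen_kball (K : fieldType) (R : realType) (absK : K -> R) (a : K)
    (r : R) :
  local_field_abs absK -> kopen absK (kball absK a r).
Proof.
move=> HK x; rewrite /kball /= => xa.
(* Every point of an ultrametric ball is a centre of it, so the radius can be kept. *)
exists r => [|y /= yx]; first by apply: le_lt_trans xa; case: HK.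
by apply: le_lt_trans (absK_dist_max _ x _ HK) _; rewrite gt_max yx.
Qed.

(** Bernoulli's inequality [n (t - 1) <= t ^+ n] combined with the Archimedean property. *)
Lemma expr_unbounded (R : realType) (t x : R) :
  1 < t -> exists n, x <= t ^+ n.
Proof.
move=> t1.
have bernoulli n : n%:R * (t - 1) <= t ^+ n.
  elim: n => [|n IH]; first by rewrite mul0r expr0.
  rewrite exprS -natr1 mulrDl mul1r.
  have -> : t * t ^+ n = t ^+ n + (t - 1) * t ^+ n.
    by rewrite mulrBl mul1r addrC subrK.
  by apply: lerD => //; apply: ler_peMr; rewrite ?subr_ge0 ?exprn_ege1// ltW.
exists (Num.bound `|x / (t - 1)|); apply: le_trans (bernoulli _).
rewrite -ler_pdivrMr ?subr_gt0//; apply: le_trans (ler_norm _) _.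
exact/ltW/archi_boundP.
Qed.

(** Nontriviality gives [x] with absolute value neither 0 nor 1; either [x] or its inverse works. *)
Lemma absK_gt1 (K : fieldType) (R : realType) (absK : K -> R) :
  local_field_abs absK -> exists t, 1 < absK t.
Proof.
move=> HK; have [abs1 _] := absK_normalized HK.
case: HK => abs0 [abs_eq0 absM _ [x [x0 x1]] _].
have [x_gt1|x_le1] := ltP 1 (absK x); first by exists x.
have xx : absK x * absK x^-1 = 1.
  by rewrite -absM divff// -?abs1//; apply: contraNneq x0 => ->; apply/eqP/abs_eq0.
exists x^-1; have x_gt0 : 0 < absK x by rewrite lt_def x0 abs0.
by rewrite -(ltr_pM2l x_gt0) xx mulr1 lt_def eq_sym x1.
Qed.

(** Fix [t] with [absK t > 1]. By compactness the unit ball has a finite net at scale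
    [r / absK t ^+ n]; multiplied by [t ^+ n] it becomes a finite [r]-net of the ball of radius
    [absK t ^+ n]. These balls exhaust [K]. *)
Lemma countable_net (K : fieldType) (R : realType) (absK : K -> R) (r : R) :
  local_field_abs absK -> 0 < r ->
  exists2 D : set K, countable D &
    forall x, exists2 a, D a & absK (x - a) < r.
Proof.
move=> HK r0; have [t t1] := absK_gt1 HK; have [abs1 _] := absK_normalized HK.
have Kball := fun a e => @kopen_kball _ _ _ a e HK.
case: HK => abs0 [abs_eq0 absM absD _ cpt].
have absX n : absK (t ^+ n) = absK t ^+ n.
  by elim: n => [|n IH]; rewrite ?expr0// !exprS absM IH.
have t0 : 0 < absK t := lt_trans ltr01 t1.
have tn0 n : 0 < absK t ^+ n by rewrite exprn_gt0.
have net n : exists D : set K, finite_set D /\ forall x, absK x <= 1 ->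
    exists2 a, D a & absK (x - a) < r / absK t ^+ n.
  have [|D finD cov] :=
      cpt K (fun a => kball absK a (r / absK t ^+ n)) (fun a => Kball a _).
    move=> x _; exists x => //; rewrite /kball /= subrr.
    have -> : absK 0 = 0 by apply/abs_eq0.
    by rewrite divr_gt0.
  by exists D; split => // x /cov[a Da xa]; exists a.
have [D /all_and2[finD Dnet]] := choice net.
exists (\bigcup_n [set t ^+ n * a | a in D n]).
  apply: bigcup_countable => // n _.
  by apply/finite_set_countable/finite_image.
move=> x; have [n xn] := expr_unbounded (absK x) t1.
have tnn0 : t ^+ n != 0.
  by apply/eqP => /abs_eq0; rewrite absX => /eqP; rewrite gt_eqF.
have [|a Da xa] := Dnet n (x / t ^+ n).
  rewrite -(ler_pM2r (tn0 n)) mul1r -[X in _ * X]absX -absM divfK//.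
exists (t ^+ n * a); first by exists n => //; exists a.
rewrite ltr_pdivlMr// -absX -absM mulrBl divfK// in xa.
by rewrite mulrC.
Qed.

(* In an ultrametric space |X - Y| < r iff X and Y lie in a common r-ball
   centred in a given r-net; a countable net makes this a countable union. *)
Lemma measurable_absK_dist (K : fieldType) (R : realType) (absK : K -> R)
    (d : measure_display) (T : measurableType d) (X Y : T -> K) :
  local_field_abs absK ->
  kmeasurable absK (@measurable d T) X -> kmeasurable absK (@measurable d T) Y ->
  measurable_fun setT (fun w => absK (X w - Y w)).
Proof.
move=> HK mX mY.
apply: (measurability _ (RGenInftyO.measurableE R)) => _ [_ [r ->] <-].
rewrite setTI.
have [r0|r0] := leP r 0.
  rewrite (_ : _ @^-1` _ = set0)//; apply/seteqP; split => // w /=.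
  rewrite in_itv/= => /lt_le_trans/(_ r0); rewrite ltNge.
  by case: HK => ->.
have [D cD Dnet] := countable_net HK r0.
rewrite (_ : _ @^-1` _ = \bigcup_(a in D)
    (X @^-1` kball absK a r `&` Y @^-1` kball absK a r)).
  rewrite bigcup_set_type; apply: countable_bigcupT_measurable => [|a].
    have /countable_injP[f finj] := cD.
    apply/countable_injP; exists (f \o val) => a b _ _ /= fab.
    by apply/val_inj/finj => //; exact: valP.
  by apply: measurableI; [apply: mX|apply: mY]; exact: kopen_kball.
apply/seteqP; split => w /=.
  rewrite in_itv/= => XY; have [a Da Ya] := Dnet (Y w).
  exists a => //; split => //.
  by apply: le_lt_trans (absK_dist_max _ (Y w) _ HK) _; rewrite gt_max XY.
move=> [a Da [Xa Ya]]; rewrite in_itv/=.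
apply: le_lt_trans (absK_dist_max _ a _ HK) _.
by rewrite gt_max (absK_distC a) // Xa.
Qed.

(** * Real roots and geometric bounds *)

(** Negative [x] is allowed, so the lemma applies pointwise to versions of a conditional
    expectation, which may be negative on a null set. *)
Lemma powR_inv_le (R : realType) (x c : R) (n : nat) :
  0 <= c -> x `^ (n.+1%:R^-1) <= c -> x <= c ^+ n.+1.
Proof.
move=> c0 xc; have [x0|x0] := leP 0 x; last exact: le_trans (ltW x0) (exprn_ge0 _ c0).
have -> : x = (x `^ n.+1%:R^-1) ^+ n.+1.
  by rewrite -powR_mulrn ?powR_ge0// -powRrM mulVf ?pnatr_eq0// powRr1.
by rewrite lerXn2r ?nnegrE ?powR_ge0.
Qed.

Lemma powR_inv_exprn_le (R : realType) (x c : R) (n : nat) :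
  0 <= x -> 0 <= c -> x <= c ^+ n.+1 -> x `^ (n.+1%:R^-1) <= c.
Proof.
move=> x0 c0 xc.
have -> : c = (c ^+ n.+1) `^ n.+1%:R^-1.
  by rewrite -powR_mulrn// -powRrM mulfV ?pnatr_eq0// powRr1.
have ninv0 : 0 <= n.+1%:R^-1 :> R by rewrite invr_ge0.
by apply: (ge0_ler_powR ninv0) xc; rewrite nnegrE ?exprn_ge0.
Qed.

Lemma le_geometric_eq0 (R : realType) (x z : R) :
  0 <= x -> 0 <= z < 1 -> (forall n, x <= z ^+ n) -> x = 0.
Proof.
move=> x0 /andP[z0 z1] xz; apply/eqP; rewrite eq_le x0 andbT.
have /cvg_expr z_cvg : `|z| < 1 by rewrite ger0_norm.
rewrite -(cvg_lim (@Rhausdorff R) z_cvg).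
by apply: limr_ge; [apply/cvg_ex; exists 0|exact: nearW].
Qed.

(** * The conditional essential supremum as least measurable upper bound *)

(** Values of [powR] are nonnegative for every base, so this holds at every point and not merely
    almost everywhere. *)
Lemma cond_esssup_ge0 (d : measure_display) (T : measurableType d)
    (R : realType) (P : probability T R) (G : set (set T)) (S : T -> R)
    (V : T -> \bar R) :
  is_cond_esssup P G S V -> forall w, (0 <= V w)%E.
Proof.
move=> [W [_ ->]] w; apply: le_trans (ereal_sup_ubound _); last by exists 0%N.
by rewrite lee_fin powR_ge0.
Qed.

(** A sublevel set of a countable supremum is the intersection of the sublevel sets of its terms.
    This is the form in which G-measurability of the extended-real [V] is used. *)
Lemma cond_esssup_sublevel (d : measure_display) (T : measurableType d)
    (R : realType) (P : probability T R) (G : set (set T)) (S : T -> R)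
    (V : T -> \bar R) (c : R) :
  sub_sigma_field G -> is_cond_esssup P G S V ->
  G [set w | (V w <= c%:E)%E].
Proof.
move=> [sG GF] [W [cW ->]].
rewrite -(measurable_g_measurableTypeE sG).
rewrite (_ : [set w | _] = \bigcap_p
    (W p @^-1` ((fun x => x `^ (p.+1%:R^-1)) @^-1` `]-oo, c]))); last first.
  apply/seteqP; split => w /=.
    move=> Vc p _ /=; rewrite in_itv/= -lee_fin; apply: le_trans Vc.
    by apply: ereal_sup_ubound; exists p.
  move=> Wc; apply: ge_ereal_sup => _ [p _ <-].
  by have := Wc p I; rewrite /= in_itv/= lee_fin.
apply: bigcapT_measurable => p; rewrite measurable_g_measurableTypeE//.
have [mW _ _] := cW p; apply: mW.
rewrite -[X in measurable X]setTI; apply: measurable_powR => //.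
Qed.

Lemma ae_of_measure0 (d : measure_display) (T : measurableType d)
    (R : realType) (mu : {measure set T -> \bar R}) (A : set T)
    (Q : T -> Prop) :
  measurable A -> mu A = 0%E -> (forall w, ~ Q w -> A w) ->
  {ae mu, forall w, Q w}.
Proof. by move=> mA A0 QA; exists A; split. Qed.

(* Chebyshev for every power: on A = {V <= c}, integrating S^(p+1) bounds
   P(A, S >= c') by (c / c')^(p+1), which tends to 0. *)
Lemma cond_esssup_level (d : measure_display) (T : measurableType d)
    (R : realType) (P : probability T R) (G : set (set T)) (S : T -> R)
    (V : T -> \bar R) (c c' : R) :
  sub_sigma_field G -> measurable_fun setT S -> (forall w, 0 <= S w) ->
  is_cond_esssup P G S V -> 0 <= c -> c < c' ->
  {ae P, forall w, (V w <= c%:E)%E -> S w < c'}.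
Proof.
move=> sG mS S0 VS c0 cc'.
have GA := cond_esssup_sublevel c sG VS.
have [W [cW VE]] := VS.
set A := [set w | _] in GA.
have mA : measurable A by case: sG => _; apply.
have c'0 : 0 < c' := le_lt_trans c0 cc'.
pose B := A `&` S @^-1` `[c', +oo[.
have mS' : measurable (S @^-1` `[c', +oo[).
  by rewrite -[X in measurable X]setTI; exact: mS.
have mB : measurable B by exact: measurableI.
apply: (@ae_of_measure0 _ _ _ _ B) => //; last first.
  move=> w /not_implyP[Vw /negP]; rewrite -leNgt => Sw; split => //=.
  by rewrite in_itv/= andbT.
have PBfin : P B \is a fin_num by exact: fin_num_measure.
have PB1 p : (c' ^+ p.+1 * fine (P B) <= c ^+ p.+1)%R.
  rewrite -lee_fin EFinM fineK//.
  have [mW iW IW] := cW p.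
  have mSp D : measurable_fun D (fun w => (S w ^+ p.+1)%:E).
    by apply: measurable_funTS; apply/measurable_EFinP/measurable_funX.
  (* Lower half of the chain: [S >= c'] on [B], and [B] is contained in [A]. *)
  apply: (@le_trans _ _ (\int[P]_(w in A) (S w ^+ p.+1)%:E)%E).
    rewrite -integral_cst//.
    apply: (@le_trans _ _ (\int[P]_(w in B) (S w ^+ p.+1)%:E)%E).
      apply: ge0_le_integral => //.
      - by move=> w _; rewrite lee_fin exprn_ge0// ltW.
      - move=> w [_ /=]; rewrite in_itv/= andbT => Sw.
        by rewrite lee_fin lerXn2r ?nnegrE// ltW.
    apply: ge0_subset_integral => //.
      by move=> w _; rewrite lee_fin exprn_ge0.
    exact: subIsetl.
  (* Since [A] lies in [G], the integral of [S ^+ p.+1] over it equals that of [W p], which is at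
     most [c ^+ p.+1] on [A]. *)
  rewrite -IW//.
  apply: (@le_trans _ _ (\int[P]_(w in A) cst (c ^+ p.+1)%:E w)%E).
    apply: le_integral => //.
    - exact: integrableS iW.
    - exact: finite_measure_integrable_cst.
    - move=> w /set_mem Aw; rewrite lee_fin; apply: powR_inv_le => //.
      rewrite -lee_fin; apply: le_trans Aw.
      by rewrite VE; apply: ereal_sup_ubound; exists p.
  rewrite integral_cst// -[leRHS]mule1; apply: lee_wpmul2l.
    by rewrite lee_fin exprn_ge0.
  exact: probability_le1.
suff PB0 : fine (P B) = 0 by apply/eqP; rewrite -fine_eq0// PB0.
apply: (@le_geometric_eq0 _ _ (c / c')).
- exact: fine_ge0.
- by rewrite divr_ge0 ?(ltW c'0)//= ltr_pdivrMr// mul1r.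
(* [PB1] covers the exponents from 1 on; exponent 0 only asks that a probability be at most 1. *)
move=> [|p]; last by rewrite exprMn exprVn ler_pdivlMr ?exprn_gt0// mulrC.
by rewrite expr0 -lee_fin fineK//; exact: probability_le1.
Qed.

(** If [v < x], rationals with [v < q < q' < x] contradict the hypothesis. Two heights occur because
    the Chebyshev argument bounds [S] only strictly above the level of [V]. *)
Lemma lee_of_rat_levels (R : realType) (x : R) (v : \bar R) :
  (0 <= v)%E ->
  (forall q q' : rat, 0 <= ratr q :> R -> ratr q < ratr q' :> R ->
    (v <= (ratr q)%:E)%E -> x < ratr q') -> (x%:E <= v)%E.
Proof.
case: v => [v||] v0 H; rewrite ?leey//.
rewrite lee_fin leNgt; apply/negP => vx.
have [q'] := rat_in_itvoo vx; rewrite in_itv/= => /andP[vq' q'x].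
have [q] := rat_in_itvoo vq'; rewrite in_itv/= => /andP[vq qq'].
rewrite lee_fin in v0.
have := H q q' (ltW (le_lt_trans v0 vq)) qq'.
by rewrite lee_fin => /(_ (ltW vq)); rewrite ltNge (ltW q'x).
Qed.

Lemma le_cond_esssup (d : measure_display) (T : measurableType d)
    (R : realType) (P : probability T R) (G : set (set T)) (S : T -> R)
    (V : T -> \bar R) :
  sub_sigma_field G -> measurable_fun setT S -> (forall w, 0 <= S w) ->
  is_cond_esssup P G S V -> {ae P, forall w, ((S w)%:E <= V w)%E}.
Proof.
move=> sG mS S0 VS.
have : {ae P, forall w (q q' : rat), 0 <= ratr q :> R -> ratr q < ratr q' :> R ->
    (V w <= (ratr q)%:E)%E -> S w < ratr q'}.
  apply: ae_forall_countable => q; apply: ae_forall_countable => q'.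
  have [q0|q0] := boolP (0 <= ratr q :> R); last exact: aeW.
  have [qq'|qq'] := boolP (ratr q < ratr q' :> R); last exact: aeW.
  by have := cond_esssup_level sG mS S0 VS q0 qq'; apply: filterS => w H _ _.
apply: filterS => w H; apply: lee_of_rat_levels H.
exact: (cond_esssup_ge0 VS).
Qed.

(** The set [A] where [W < 0] lies in [G], and there [-W] is positive with integral equal to minus
    that of [S], hence at most 0. *)
Lemma cexp_version_ge0 (d : measure_display) (T : measurableType d)
    (R : realType) (P : probability T R) (G : set (set T)) (S W : T -> R) :
  sub_sigma_field G -> (forall w, 0 <= S w) -> cexp_version P G S W ->
  {ae P, forall w, 0 <= W w}.
Proof.
move=> sG S0 [mW iW IW].
pose A := W @^-1` `]-oo, 0[.
have GA : G A by exact: mW.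
have mA : measurable A by case: sG => _; apply.
apply: (@ae_of_measure0 _ _ _ _ A) => //; last first.
  by move=> w /negP; rewrite -ltNge /A /= in_itv.
have mWf := rmeasurable_measurable_fun sG mW.
have iWA : P.-integrable A (EFin \o W) by exact: integrableS iW.
apply: (@measure0_integral_gt0 _ _ _ _ _ (fun w => 0%:E - (W w)%:E)%E) => //.
- apply: measurable_funTS; apply: emeasurable_funB => //.
  exact/measurable_EFinP.
- move=> w; rewrite /A /= in_itv/= => Ww.
  by rewrite -EFinB lte_fin subr_gt0.
rewrite integralB//=; last exact: integrable0.
rewrite integral0 sub0e oppe_le0 IW//.
by apply: integral_ge0 => w _; rewrite lee_fin.
Qed.

(** The part [B] of [A] where [W > c] lies in [G], so [W - c] has the same integral over it as
    [S - c], which is at most 0. Localising to [A] allows a different constant on each sublevel set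
    of a random bound. *)
Lemma cexp_version_le_on (d : measure_display) (T : measurableType d)
    (R : realType) (P : probability T R) (G : set (set T)) (S W : T -> R)
    (A : set T) (c : R) :
  sub_sigma_field G -> measurable_fun setT S -> (forall w, 0 <= S w) ->
  cexp_version P G S W -> G A -> 0 <= c ->
  {ae P, forall w, A w -> S w <= c} -> {ae P, forall w, A w -> W w <= c}.
Proof.
move=> sG mS S0 [mW iW IW] GA c0 Sc.
pose B := A `&` W @^-1` `]c, +oo[.
have GB : G B.
  have [sG' _] := sG; rewrite -(measurable_g_measurableTypeE sG').
  apply: measurableI; rewrite measurable_g_measurableTypeE//.
  exact: mW.
have mB : measurable B by case: sG => _; apply.
apply: (@ae_of_measure0 _ _ _ _ B) => //; last first.
  move=> w /not_implyP[Aw /negP]; rewrite -ltNge => cW; split => //=.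
  by rewrite in_itv/= andbT.
have mWf := rmeasurable_measurable_fun sG mW.
have iWB : P.-integrable B (EFin \o W) by exact: integrableS iW.
have icB := finite_measure_integrable_cst P c mB.
apply: (@measure0_integral_gt0 _ _ _ _ _ (fun w => (W w)%:E - (cst c w)%:E)%E) => //.
- by apply: measurable_funTS; apply: emeasurable_funB; exact/measurable_EFinP.
- by move=> w [_]; rewrite /= in_itv/= andbT -EFinB lte_fin subr_gt0.
rewrite integralB//= IW// sube_le0.
apply: ae_ge0_le_integral => //.
- by move=> w _; rewrite lee_fin.
- by apply: measurable_funTS; exact/measurable_EFinP.
by apply: filterS Sc => w Sc [Aw _]; rewrite lee_fin; exact: Sc.
Qed.

(* The a.e. nonnegativity of [W p] matters: [powR] of a negative base is
   the junk value 1. *)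
Lemma cond_esssup_le (d : measure_display) (T : measurableType d)
    (R : realType) (P : probability T R) (G : set (set T)) (S : T -> R)
    (V V' : T -> \bar R) :
  sub_sigma_field G -> measurable_fun setT S -> (forall w, 0 <= S w) ->
  is_cond_esssup P G S V ->
  (forall w, (0 <= V' w)%E) -> (forall c : R, G [set w | (V' w <= c%:E)%E]) ->
  {ae P, forall w, ((S w)%:E <= V' w)%E} ->
  {ae P, forall w, (V w <= V' w)%E}.
Proof.
move=> sG mS S0 [W [cW ->]] V'0 GV' SV'.
have Sp0 p w : 0 <= S w ^+ p.+1 by rewrite exprn_ge0.
have : {ae P, forall w (p : nat) (q : rat), 0 <= W p w /\
    (0 <= ratr q :> R -> (V' w <= (ratr q)%:E)%E -> W p w <= ratr q ^+ p.+1)}.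
  apply: ae_forall_countable => p; apply: ae_forall_countable => q.
  have W0 := cexp_version_ge0 sG (Sp0 p) (cW p).
  have [q0|q0] := boolP (0 <= ratr q :> R); last by apply: filterS W0.
  have mSp : measurable_fun setT (fun w => S w ^+ p.+1) by exact: measurable_funX.
  suff Wq : {ae P, forall w, (V' w <= (ratr q)%:E)%E -> W p w <= ratr q ^+ p.+1}.
    by apply: filterS2 W0 Wq => w ? ?; split.
  (* On the G-set where [V' <= q], also [S <= q] a.e., so the bound on [S ^+ p.+1] passes to
     [W p]. *)
  apply: (cexp_version_le_on sG mSp (Sp0 p) (cW p) (GV' (ratr q))).
    exact: exprn_ge0.
  apply: filterS SV' => w SV' V'q; rewrite lerXn2r ?nnegrE// -lee_fin.
  exact: le_trans SV' V'q.
apply: filterS => w H; apply: ge_ereal_sup => _ [p _ <-].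
apply: lee_of_rat_levels => // q q' q0 qq' V'q.
have [W0 Wq] := H p q; apply: le_lt_trans qq'.
by apply: powR_inv_exprn_le => //; exact: Wq.
Qed.

(** Essential boundedness makes every power of [S] integrable, so each has a conditional
    expectation; choice selects the whole sequence. *)
Lemma cond_esssup_exists (d : measure_display) (T : measurableType d)
    (R : realType) (P : probability T R) (G : set (set T)) (S : T -> R)
    (M : R) :
  sub_sigma_field G -> measurable_fun setT S -> (forall w, 0 <= S w) ->
  {ae P, forall w, S w <= M} -> exists V, is_cond_esssup P G S V.
Proof.
move=> sG mS S0 SM.
have ex p : exists W, cexp_version P G (fun w => S w ^+ p.+1) W.
  have mSp : measurable_fun setT (EFin \o (fun w => S w ^+ p.+1)).
    by apply/measurable_EFinP; exact: measurable_funX.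
  apply: cexp_version_exists => //; apply/integrableP; split => //.
  (* The absolute value supplies a nonnegative bound whatever the sign of [M]. *)
  apply: (@le_lt_trans _ _ (\int[P]_(w in setT) cst (`|M| ^+ p.+1)%:E w)%E).
    apply: ae_ge0_le_integral => //.
    - exact: measurableT_comp.
    - by move=> w _; rewrite lee_fin exprn_ge0.
    apply: filterS SM => w SM _; rewrite /= lee_fin ger0_norm ?exprn_ge0//.
    by rewrite lerXn2r ?nnegrE//; exact: le_trans SM (ler_norm _).
  rewrite integral_cst//; apply: (@le_lt_trans _ _ ((`|M| ^+ p.+1)%:E * 1)%E).
    by apply: lee_wpmul2l; rewrite ?lee_fin ?exprn_ge0 ?probability_le1.
  by rewrite mule1 ltry.
have [W cW] := choice ex.
by eexists; exists W.
Qed.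

Lemma Linf_absK_dist_bounded (K : fieldType) (R : realType) (absK : K -> R)
    (d : measure_display) (T : measurableType d) (P : probability T R)
    (G H : set (set T)) (X Y : T -> K) :
  local_field_abs absK -> Linf P absK G X -> Linf P absK H Y ->
  exists M, {ae P, forall w, absK (X w - Y w) <= M}.
Proof.
move=> HK [_ [M XM]] [_ [N YN]]; exists (Num.max M N).
apply: filterS2 XM YN => w XM YN.
apply: le_trans (absK_dist_max _ 0 _ HK) _.
by rewrite (absK_distC 0)// !subr0 le_max2.
Qed.

(** * The tower property *)

Theorem mainTheorem15 (K : fieldType) (R : realType) (absK : K -> R)
  (HK : local_field_abs absK)
  (d : measure_display) (T : measurableType d) (P : probability T R)
  (G H : set (set T)) (HG : sub_sigma_field G) (HH : sub_sigma_field H)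
  (HGH : G `<=` H)
  (X Y Z : T -> K)
  (hX : Linf P absK (@measurable d T) X)
  (hY : in_cond_exp P absK H X Y)
  (hZ : in_cond_exp P absK G Y Z) :
  in_cond_exp P absK G X Z.
Proof.
have [LY minY] := hY; have [LZ minZ] := hZ; split => // Z' LZ' V1 V2 hV1 hV2.
have absK0 x : 0 <= absK x by case: HK.
have LF F U : sub_sigma_field F -> Linf P absK F U ->
    Linf P absK (@measurable d T) U.
  by move=> [_ FM] [mU bU]; split => // O oO; apply/FM/mU.
have LYF := LF _ _ HH LY; have LZF := LF _ _ HG LZ; have LZ'F := LF _ _ HG LZ'.
(* This makes [Z'] an admissible competitor of [Y] over [H]. *)
have LZ'H : Linf P absK H Z'.
  by case: LZ' => mZ' bZ'; split => // O oO; apply/HGH/mZ'.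
have mdist A B : Linf P absK (@measurable d T) A ->
    Linf P absK (@measurable d T) B ->
    measurable_fun setT (fun w => absK (A w - B w)).
  by move=> [mA _] [mB _]; exact: measurable_absK_dist.
have exV F A B : sub_sigma_field F -> Linf P absK (@measurable d T) A ->
    Linf P absK (@measurable d T) B ->
    exists V, is_cond_esssup P F (fun w => absK (A w - B w)) V.
  move=> sF LA LB; have [M ABM] := Linf_absK_dist_bounded HK LA LB.
  by apply: cond_esssup_exists ABM => //; exact: mdist.
have V20 := cond_esssup_ge0 hV2.
have GV2 c := cond_esssup_sublevel c HG hV2.
have XZ'V2 : {ae P, forall w, ((absK (X w - Z' w))%:E <= V2 w)%E}.
  by apply: le_cond_esssup hV2 => //; exact: mdist.
have XYV2 : {ae P, forall w, ((absK (X w - Y w))%:E <= V2 w)%E}.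
  have [U hU] := exV H X Y HH hX LYF; have [U' hU'] := exV H X Z' HH hX LZ'F.
  have XYU := le_cond_esssup HH (mdist _ _ hX LYF) (fun=> absK0 _) hU.
  have UU' := minY Z' LZ'H U U' hU hU'.
  (* The sublevel sets of [V2] lie in [G], hence in [H], so [V2] bounds the supremum conditional on
     [H] as well. *)
  have U'V2 := cond_esssup_le HH (mdist _ _ hX LZ'F) (fun=> absK0 _) hU' V20
    (fun c => HGH _ (GV2 c)) XZ'V2.
  apply: filterS3 XYU UU' U'V2 => w XYU UU' U'V2.
  exact: le_trans XYU (le_trans UU' U'V2).
have YZ'V2 : {ae P, forall w, ((absK (Y w - Z' w))%:E <= V2 w)%E}.
  apply: filterS2 XYV2 XZ'V2 => w XY XZ'.
  apply: (@le_trans _ _ (Num.max (absK (Y w - X w)) (absK (X w - Z' w)))%:E).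
    by rewrite lee_fin; exact: absK_dist_max.
  by rewrite EFin_max ge_max absK_distC// XY.
have YZV2 : {ae P, forall w, ((absK (Y w - Z w))%:E <= V2 w)%E}.
  have [U hU] := exV G Y Z HG LYF LZF; have [U' hU'] := exV G Y Z' HG LYF LZ'F.
  have YZU := le_cond_esssup HG (mdist _ _ LYF LZF) (fun=> absK0 _) hU.
  have UU' := minZ Z' LZ' U U' hU hU'.
  have U'V2 := cond_esssup_le HG (mdist _ _ LYF LZ'F) (fun=> absK0 _) hU' V20
    GV2 YZ'V2.
  apply: filterS3 YZU UU' U'V2 => w YZU UU' U'V2.
  exact: le_trans YZU (le_trans UU' U'V2).
(* By leastness over [G] it remains to bound [absK (X w - Z w)] itself by [V2], passing through
   [Y]. *)
apply: (cond_esssup_le HG (mdist _ _ hX LZF) (fun=> absK0 _) hV1 V20 GV2).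
apply: filterS2 XYV2 YZV2 => w XY YZ.
apply: (@le_trans _ _ (Num.max (absK (X w - Y w)) (absK (Y w - Z w)))%:E).
  by rewrite lee_fin; exact: absK_dist_max.
by rewrite EFin_max ge_max XY.
Qed.
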